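(* For integers $n,k\ge 1$, let $U(n,k)$ be the smallest number $N$ such that for every Streett automaton $\mathcal{A}$ (over any finite alphabet $\Sigma$) with $n$ states and $k$ Streett pairs there is a nondeterministic Büchi automaton with at most $N$ states whose language is $\Sigma^{\omega}\setminus\mathscr{L}(\mathcal{A})$. Then $U(n,k)=2^{O(n\lg n+nk\lg k)}$ when $k=O(n)$, and $U(n,k)=2^{O(n^{2}\lg n)}$ when $k=\omega(n)$.
   Context: An $\omega$-automaton is a tuple $\mathcal{A}=(\Sigma,Q,Q_0,\Delta,\mathcal{F})$ with finite alphabet $\Sigma$, finite state set $Q$, initial states $Q_0\subseteq Q$, transitions $\Delta\subseteq Q\times\Sigma\times Q$ and acceptance condition $\mathcal{F}$. A run over an infinite word $w\in\Sigma^\omega$ is a sequence $\varrho\in Q^\omega$ with $\varrho(0)\in Q_0$ and $(\varrho(i),w(i),\varrho(i+1))\in\Delta$ for all $i$; $\mathrm{Inf}(\varrho)$ is the set of states occurring infinitely often in $\varrho$. The automaton accepts $w$ if some run over $w$ satisfies $\mathcal{F}$; $\mathscr{L}(\mathcal{A})$ is the set of accepted words. With $I=\{1,\dots,k\}$ and $G,B:I\to 2^{Q}$, the Streett condition $\langle G,B\rangle_I$ (with $k$ pairs) is: for all $i\in I$, if $\mathrm{Inf}(\varrho)\cap G(i)\neq\emptyset$ then $\mathrm{Inf}(\varrho)\cap B(i)\neq\emptyset$. A Büchi automaton has a condition given by a set $F\subseteq Q$: $\mathrm{Inf}(\varrho)\cap F\neq\emptyset$. Here $n=|Q|$ and $\lg$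 is the base-2 logarithm; the asymptotic statements are in the parameters $n,k$. *)

(* Defs.v *)
From HB Require Import structures.
From mathcomp Require Import all_boot all_order all_algebra.
From mathcomp Require Import all_classical all_reals all_analysis.

Set Implicit Arguments.
Unset Strict Implicit.
Unset Printing Implicit Defensive.

Import Order.TTheory GRing.Theory Num.Theory.
Import numFieldNormedType.Exports.

Local Open Scope classical_set_scope.

(* Infinite words over T are functions nat -> T. *)
Record omega_automaton (Sigma : finType) := OmegaAutomaton {
  state : finType;
  init : {set state};
  trans : {set state * Sigma * state};
  acceptance : set (nat -> state) }.
Arguments acceptance {Sigma} o.

Definition is_run (Sigma : finType) (A : omega_automaton Sigma)
    (w : nat -> Sigma) (rho : nat -> state A) : Prop :=
  rho 0 \in init A /\ forall i, (rho i, w i, rho i.+1) \in trans A.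

Definition language (Sigma : finType) (A : omega_automaton Sigma) :
    set (nat -> Sigma) :=
  [set w | exists rho, is_run w rho /\ acceptance A rho].

Definition Inf (Q : finType) (rho : nat -> Q) : {set Q} :=
  [set q | `[< forall i, exists j, i <= j /\ rho j = q >]]%SET.

(* finset.set0 is spelled out because classical_sets shadows set0. *)
Definition streett_condition (Q : finType) (k : nat) (G B : 'I_k -> {set Q}) :
    set (nat -> Q) :=
  [set rho | forall i : 'I_k, Inf rho :&: G i != finset.set0 ->
                              Inf rho :&: B i != finset.set0].

Definition buchi_condition (Q : finType) (F : {set Q}) : set (nat -> Q) :=
  [set rho | Inf rho :&: F != finset.set0].

Definition is_streett (Sigma : finType) (k : nat) (A : omega_automaton Sigma) :
    Prop :=
  exists G B : 'I_k -> {set state A}, acceptance A = streett_condition G B.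

Definition is_buchi (Sigma : finType) (A : omega_automaton Sigma) : Prop :=
  exists F : {set state A}, acceptance A = buchi_condition F.

Definition complementation_bound (n k N : nat) : Prop :=
  forall (Sigma : finType) (A : omega_automaton Sigma),
    is_streett k A -> #|state A| = n ->
    exists C : omega_automaton Sigma,
      [/\ is_buchi C, #|state C| <= N & language C = ~` language A].

Definition is_smallest (P : nat -> Prop) (N : nat) : Prop :=
  P N /\ forall M, P M -> N <= M.

Local Open Scope ring_scope.

Definition lg (R : realType) (x : R) : R := ln x / ln 2.

(* f(n) = 2^{O(g(n))} as n tends to infinity: f = 2^h for some h = O(g). *)
Definition exp2_bigO (R : realType) (f : nat -> nat) (g : nat -> R) : Prop :=
  exists h : nat -> R,
    h =O_\oo g /\ forall n, (0 < n)%N -> (f n)%:R = 2 `^ h n.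

(* Main.v *)
(** A word is rejected when every path of its run DAG visits some [G j]
    infinitely often and [B j] only finitely often.  Such a DAG is peeled
    recursively.  Let [E] be a set of states known to be absent from a sub-DAG
    [X] that also avoids every [G j] with [B j] inside [E].  Restrict [X] to the
    vertices starting an infinite path.  Some vertex [v] cannot reach a suitable
    part [b l], not inside [E], of some [B j]: otherwise a path could visit
    infinitely often all the [B j] not inside [E].  The vertices below [v] form a tree root with
    label [l]; inside it, [E] grows by [b l] and the vertices of the newly
    avoidable [G j] are set apart; the rest of [X] is strictly narrower.  Since
    each root contains an infinite path, all roots are inhabited at every late
    time, so the forest has at most [n |L|] nodes and does not depend on time.

    The complement automaton guesses the forest once and, at each time, a place
    in it for each reachable state; it checks that places do not move to the
    right along transitions, and, with a breakpoint set, that no path stays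
    forever in one gap.  A forest with [m] nodes is a word of length [2m+1] over
    the labels and places are numbers up to [3m], which gives the bound.
    Labelling with the pairs, [b i = B i], settles [k = O(n)]; labelling with
    the states, [b q = {q}], gives a bound independent of [k].  In both cases an
    extra label with [b l0] empty is needed at the top, because [B j] may be
    empty. *)

Require Import Defs.
From HB Require Import structures.
From mathcomp Require Import all_boot.
From mathcomp Require Import boolp zify.

Set Implicit Arguments.
Unset Strict Implicit.
Unset Printing Implicit Defensive.

(** * Infinite sequences: dependent choice, limit sets, König's lemma *)

Lemma dependent_choice_at (T : Type) (P : nat -> T -> Prop)
    (R : nat -> T -> T -> Prop) s x0 :
  P s x0 ->
  (forall t x, s <= t -> P t x -> exists2 y, P t.+1 y & R t x y) ->
  exists f : nat -> T, [/\ f s = x0, forall t, s <= t -> P t (f t)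
                         & forall t, s <= t -> R t (f t) (f t.+1)].
Proof.
move=> Px0 step.
have step' t x : exists y, s <= t -> P t x -> P t.+1 y /\ R t x y.
  have [/andP[st /asboolP Px]|nP] := boolP ((s <= t) && `[< P t x >]).
    by have [y Py Ry] := step t x st Px; exists y.
  by exists x => st /asboolP Px; rewrite st Px in nP.
have [g gP] := choice (fun tx : nat * T => step' tx.1 tx.2).
pose h := fix h n := if n is m.+1 then g (s + m, h m) else x0.
have hP n : P (s + n) (h n).
  elim: n => [|n IH]; first by rewrite addn0.
  by have [] := gP (s + n, h n) (leq_addr _ _) IH; rewrite addnS.
exists (fun t => h (t - s)); split=> [|t st|t st].
- by rewrite subnn.
- by have := hP (t - s); rewrite subnKC.
- rewrite subSn //=; have := gP (s + (t - s), h (t - s)) (leq_addr _ _) (hP _).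
  by rewrite subnKC //= => -[].
Qed.

Lemma InfP (Q : finType) (rho : nat -> Q) q :
  reflect (forall i, exists2 j, i <= j & rho j = q) (q \in Inf rho).
Proof.
rewrite inE; apply: (iffP (asboolP _)) => H i; have [j] := H i.
  by case=> ? ?; exists j.
by exists j.
Qed.

(** Otherwise each [x] has a bound past which it fails, and the maximum of these finitely many
    bounds is contradictory. *)
Lemma pigeonhole_often (T : finType) (P : T -> nat -> Prop) :
  (forall i, exists2 j, i <= j & exists x, P x j) ->
  exists x, forall i, exists2 j, i <= j & P x j.
Proof.
move=> H; apply: contrapT => nP.
have fail x : exists i, forall j, i <= j -> ~ P x j.
  apply: contrapT => nQ; apply: nP; exists x => i; apply: contrapT => nR.
  by apply: nQ; exists i => j ij Pxj; apply: nR; exists j.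
have [N NP] := choice fail.
have [j jN [x Px]] := H (\max_x N x).
by apply: (NP x j) => //; apply: leq_trans jN; apply: leq_bigmax.
Qed.

Lemma Inf_meets (Q : finType) (rho : nat -> Q) (S : {set Q}) :
  (Inf rho :&: S != set0) <-> (forall i, exists2 j, i <= j & rho j \in S).
Proof.
split=> [/set0Pn[q /setIP[/InfP qI qS]] i|H].
  by have [j ij qj] := qI i; exists j => //; rewrite qj.
have [|q qP] := @pigeonhole_often _ (fun q j => rho j = q /\ q \in S).
  by move=> i; have [j ij jS] := H i; exists j => //; exists (rho j).
apply/set0Pn; exists q; rewrite inE; apply/andP; split.
  by apply/InfP => i; have [j ij []] := qP i; exists j.
by have [j _ []] := qP 0.
Qed.

(** Walking back from ever later layers gives arbitrarily long paths from layer [s]. By the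
    pigeonhole principle some state there starts paths of every length, and such a state always has
    a successor of the same kind. *)
Lemma koenig (Q : finType) (R : nat -> Q -> Q -> Prop) (S : nat -> {set Q}) s :
  (forall t, s <= t -> S t != set0) ->
  (forall t q', s <= t -> q' \in S t.+1 -> exists2 q, q \in S t & R t q q') ->
  exists2 rho, rho s \in S s & forall t, s <= t -> R t (rho t) (rho t.+1).
Proof.
move=> S0 back.
pose ext := fix ext n t q :=
  if n is m.+1 then exists2 q', R t q q' & ext m t.+1 q' else True.
have extW n t q m : m <= n -> ext n t q -> ext m t q.
  elim: n t q m => [|n IH] t q [|m] //= mn [q' Rq' eq'].
  by exists q' => //; apply: IH eq'.
pose alive t q := forall n, ext n t q.
have often_alive t (D : Q -> Prop) :
    (forall n, exists2 q, D q & ext n t q) -> exists2 q, D q & alive t q.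
  move=> H; have [|q qP] := @pigeonhole_often _ (fun q n => D q /\ ext n t q).
    by move=> i; exists i => //; have [q] := H i; exists q.
  exists q; first by have [j _ []] := qP 0.
  by move=> n; have [j nj [_]] := qP n; apply: extW.
have [q0 q0S q0a] : exists2 q, q \in S s & alive s q.
  apply: often_alive => n.
  suff back_ext m d q' : q' \in S (s + m) -> ext d (s + m) q' ->
      exists2 q, q \in S s & ext (m + d) s q.
    have [q' q'S] := set0Pn _ (S0 (s + n) (leq_addr _ _)).
    by have := back_ext n 0 q' q'S I; rewrite addn0.
  elim: m d q' => [|m IH] d q'; first by rewrite addn0 => ? ?; exists q'.
  rewrite addnS => q'S extq'; have [q qS Rq] := back _ _ (leq_addr m s) q'S.
  have [|q1 q1S] := IH d.+1 q qS; first by exists q'.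
  by rewrite addnS -addSn; exists q1.
have [|rho [rhos _ rhoR]] := dependent_choice_at (R := R) q0a; last first.
  by exists rho => //; rewrite rhos.
move=> t q _ aq; have [|q' Rq' aq'] := often_alive t.+1 (R t q); last by exists q'.
by move=> n; have [q' Rq' eq'] := aq n.+1; exists q'.
Qed.

(** * Labelled ordered forests, their codes and places *)

Inductive forest (L : Type) := Empty | Tree of L & forest L & forest L.
Arguments Empty {L}.

Fixpoint nodes L (F : forest L) : nat :=
  if F is Tree _ c r then (nodes c + nodes r).+1 else 0.

Fixpoint code L (F : forest L) : seq (option L) :=
  if F is Tree l c r then Some l :: code c ++ code r else [:: None].

Lemma size_code L (F : forest L) : size (code F) = (nodes F).*2.+1.
Proof.
elim: F => //= l c IHc r IHr.
by rewrite size_cat IHc IHr doubleS doubleD addSnnS !addnS.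
Qed.

(** Preorder codes are prefix-free, so a code can be padded to a fixed length and still be read
    back. *)
Lemma code_prefix_inj L (F F' : forest L) s s' :
  code F ++ s = code F' ++ s' -> F = F'.
Proof.
suff H : code F ++ s = code F' ++ s' -> F = F' /\ s = s' by case/H.
elim: F F' s s' => [|l c IHc r IHr] [|l' c' r'] s s' //=; first by case.
by case=> ->; rewrite -!catA => /IHc[-> /IHr[-> ->]].
Qed.

(* [Here] is the gap in front of the first tree of a forest (the only place of
   an empty one), [Stop] the root of the first tree, [In] and [Next] point
   inside the first tree and past it. *)
Inductive place := Here | Stop | In of place | Next of place.

HB.instance Definition _ := gen_eqMixin place.

Fixpoint places L (F : forest L) : seq place :=
  if F is Tree _ c r
  then [:: Here, Stop & map In (places c) ++ map Next (places r)]
  else [:: Here].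

Lemma size_places L (F : forest L) : size (places F) = (3 * nodes F).+1.
Proof.
elim: F => //= l c IHc r IHr; rewrite size_cat !size_map IHc IHr.
by rewrite mulnS mulnDr addSn !addnS.
Qed.

Fixpoint gap p :=
  match p with
  | Here => true
  | Stop => false
  | In p' | Next p' => gap p'
  end.

(* Gaps are ordered from left to right and the root of a tree stands for the
   interval of all gaps of that tree; [step p p'] says that the left end of
   [p'] is not beyond the right end of [p]. *)
Fixpoint step p p' :=
  match p, p' with
  | _, Here => true
  | Here, _ => false
  | Next p1, Next p2 => step p1 p2
  | Next _, _ => true
  | _, Next _ => false
  | In p1, In p2 => step p1 p2
  | _, _ => true
  end.

(** * Paths of places in a forest and violation of the Streett condition *)

Section StreettForest.

Variables (Q L : finType) (k : nat) (G B : 'I_k -> {set Q}) (b : L -> {set Q}).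

Implicit Types (E : {set Q}) (F : forest L) (rho : nat -> Q).

(* [b l] is the set of states that a tree with label [l] declares absent, and
   [E] accumulates these sets along a branch: visiting [good E] infinitely often
   while staying out of [E] violates the Streett condition. *)
Definition good E : {set Q} :=
  [set q | [exists j, (B j \subset E) && (q \in G j)]].

Fixpoint valid F E p q : bool :=
  match F, p with
  | _, Here => true
  | Tree l _ _, Stop => (q \notin E :|: b l) && (q \in good (E :|: b l))
  | Tree l c _, In p' => (q \notin E :|: b l) && valid c (E :|: b l) p' q
  | Tree _ _ r, Next p' => valid r E p' q
  | _, _ => false
  end.

Lemma valid_places F E p q : valid F E p q -> p \in places F.
Proof.
elim: F E p => [|l c IHc r IHr] E [||p|p] //=.
- by rewrite mem_head.
- by rewrite mem_head.
- by rewrite !inE eqxx orbT.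
- by case/andP=> _ /IHc pc; rewrite !inE mem_cat map_f ?orbT.
- by move/IHr => pr; rewrite !inE mem_cat (map_f Next) ?orbT.
Qed.

(** The rightmost gap asks nothing of a state and steps to every valid place, so it can serve as
    rank at the times before the forest takes effect. *)
Fixpoint last_gap F : place := if F is Tree _ _ r then Next (last_gap r) else Here.

Lemma valid_last_gap F E q : valid F E (last_gap F) q.
Proof. by elim: F. Qed.

Lemma step_last_gap F E p q : valid F E p q -> step (last_gap F) p.
Proof. by elim: F E p => [|l c _ r IHr] E [||p|p] //=; apply: IHr. Qed.

(** Places never move right. A path that reaches [Here] stays there; one that enters the first tree
    otherwise remains in it, and either meets [Stop] infinitely often or is eventually inside the
    children; a path that does neither lives in the remaining forest. *)
Lemma stable_or_good F E rho (p : nat -> place) s :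
  (forall t, s <= t -> valid F E (p t) (rho t)) ->
  (forall t, s <= t -> step (p t) (p t.+1)) ->
  (exists s' x, gap x /\ forall t, s' <= t -> p t = x) \/
  (exists E', (exists s', forall t, s' <= t -> rho t \notin E') /\
              forall i, exists2 t, i <= t & rho t \in good E').
Proof.
elim: F E p s => [|l c IHc r IHr] E p s vp sp.
  by left; exists s, Here; split=> // t /vp; case: (p t).
have [[s1 ss1 p1]|noHere] := pselect (exists2 s1, s <= s1 & p s1 = Here).
  left; exists s1, Here; split=> //.
  suff H d : p (s1 + d) = Here by move=> t /subnKC <-.
  elim: d => [|d IH]; first by rewrite addn0.
  have := sp (s1 + d) (leq_trans ss1 (leq_addr _ _)).
  by rewrite IH addnS; case: (p _).
pose inside x := if x is (Stop | In _) then true else false.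
have [[s1 ss1 p1]|noIn] := pselect (exists2 s1, s <= s1 & inside (p s1)).
  have ins t : s1 <= t -> inside (p t).
    move/subnKC <-; elim: (t - s1) => [|d IH]; first by rewrite addn0.
    have st := leq_trans ss1 (leq_addr d _).
    have := sp _ st; have nH : p (s1 + d).+1 <> Here.
      by move=> e; apply: noHere; exists (s1 + d).+1 => //; apply: leqW.
    by rewrite addnS; case: (p (s1 + d)) IH => //; case: (p (s1 + d).+1) nH.
  have notE t : s1 <= t -> rho t \notin E :|: b l.
    move=> st; have := vp t (leq_trans ss1 st).
    by have := ins t st; case: (p t) => //= [|?] _ /andP[].
  have [often|seldom] := pselect (forall i, exists2 t, i <= t & p t = Stop).
    right; exists (E :|: b l); split; first by exists s1.
    move=> i; have [t it pt] := often (maxn i s).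
    exists t; first by apply: leq_trans it; apply: leq_maxl.
    have := vp t (leq_trans (leq_maxr _ _) it).
    by rewrite pt /= => /andP[].
  have [i iP] : exists i, forall t, i <= t -> p t <> Stop.
    apply: contrapT => nP; apply: seldom => i; apply: contrapT => nQ; apply: nP.
    by exists i => t it pt; apply: nQ; exists t.
  pose s2 := maxn s1 i; pose un x := if x is In y then y else Here.
  have pIn t : s2 <= t -> p t = In (un (p t)).
    rewrite geq_max => /andP[/ins + /iP].
    by case: (p t).
  have ss2 t : s2 <= t -> s <= t.
    by rewrite geq_max => /andP[/(leq_trans ss1)].
  have [||[s' [x [gx px]]]|] := IHc (E :|: b l) (un \o p) s2; last by right.
  - by move=> t st; have := vp t (ss2 t st); rewrite (pIn t st) /= => /andP[].
  - move=> t st; have := sp t (ss2 t st).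
    by rewrite (pIn t st) (pIn t.+1) ?(leqW st).
  - left; exists (maxn s2 s'), (In x); split=> // t.
    by rewrite geq_max => /andP[/pIn -> /px /= ->].
pose un x := if x is Next y then y else Here.
have pNext t : s <= t -> p t = Next (un (p t)).
  move=> st; case E1 : (p t) => [||x|x] //.
  - by case: noHere; exists t.
  - by case: noIn; exists t; rewrite ?E1.
  - by case: noIn; exists t; rewrite ?E1.
have [||[s' [x [gx px]]]|] := IHr E (un \o p) s; last by right.
- by move=> t st; have := vp t st; rewrite (pNext t st).
- by move=> t st; have := sp t st; rewrite (pNext t st) (pNext t.+1) ?(leqW st).
- left; exists (maxn s s'), (Next x); split=> // t.
  by rewrite geq_max => /andP[/pNext -> /px /= ->].
Qed.

Lemma good_often_not_streett E rho :
  (exists s, forall t, s <= t -> rho t \notin E) ->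
  (forall i, exists2 t, i <= t & rho t \in good E) ->
  ~ streett_condition G B rho.
Proof.
move=> [s sE] /Inf_meets /set0Pn[q /setIP[qI]].
rewrite inE => /existsP[j /andP[BE qG]] streett.
have /streett : Inf rho :&: G j != set0 by apply/set0Pn; exists q; rewrite inE qI.
move/Inf_meets/(_ s) => [t /sE nE]; move/(subsetP BE).
exact/negP.
Qed.


(** * Peeling a rejecting run DAG into a forest *)

Variable edge : nat -> Q -> Q -> bool.

Implicit Types X A Y : nat -> {set Q}.

Definition ipath X s rho :=
  forall t, s <= t -> rho t \in X t /\ edge t (rho t) (rho t.+1).

Lemma ipath_sub X X' s rho :
  (forall t, X t \subset X' t) -> ipath X s rho -> ipath X' s rho.
Proof. by move=> XX' Xrho t /Xrho[/(subsetP (XX' t))]. Qed.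

Lemma ipath_suffix X s s' rho : s <= s' -> ipath X s rho -> ipath X s' rho.
Proof. by move=> ss' Xrho t s't; apply/Xrho/(leq_trans ss'). Qed.

Definition alive X t : {set Q} :=
  [set q | `[< exists2 rho, ipath X t rho & rho t = q >]].

Lemma aliveP X t q :
  reflect (exists2 rho, ipath X t rho & rho t = q) (q \in alive X t).
Proof. by rewrite inE; apply: asboolP. Qed.

Lemma alive_sub X t : alive X t \subset X t.
Proof. by apply/subsetP => q /aliveP[rho /(_ t (leqnn t))[? _] <-]. Qed.

Lemma alive_succ X t q :
  q \in alive X t -> exists2 q', q' \in alive X t.+1 & edge t q q'.
Proof.
case/aliveP=> rho Xrho <-; exists (rho t.+1); last by have [] := Xrho t.
by apply/aliveP; exists rho => //; apply: ipath_suffix Xrho.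
Qed.

Lemma alive_pred X t q q' :
  q \in X t -> edge t q q' -> q' \in alive X t.+1 -> q \in alive X t.
Proof.
move=> qX qq' /aliveP[rho Xrho rhot]; apply/aliveP.
exists (fun u => if u == t then q else rho u); last by rewrite eqxx.
move=> u; rewrite leq_eqVlt => /predU1P[<-|tu].
  by rewrite eqxx gtn_eqF // rhot.
by rewrite !gtn_eqF ?(leqW tu) //; apply: Xrho.
Qed.

Fixpoint below X s v t : {set Q} :=
  if s == t then [set v] else
  if t is u.+1 then [set q in X t | [exists q' in below X s v u, edge u q' q]]
  else set0.

Lemma below_sub X s v t : v \in X s -> below X s v t \subset X t.
Proof.
move=> vX; case: t => [|t] /=; case: eqP => [<-|_]; rewrite ?sub1set ?sub0set //.
by apply/subsetP => q; rewrite inE => /andP[].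
Qed.

Lemma below_leq X s v t q : q \in below X s v t -> s <= t.
Proof.
elim: t q => [|t IH] q /=; case: eqP => [->|_] //; rewrite inE //.
by case/andP=> _ /exists_inP[q' /IH st _]; apply: leqW.
Qed.

Lemma below_step X s v t q q' :
  q \in below X s v t -> edge t q q' -> q' \in X t.+1 -> q' \in below X s v t.+1.
Proof.
move=> qY qq' q'X; have := below_leq qY; rewrite -ltnS /= => /ltn_eqF ->.
by rewrite inE q'X /=; apply/exists_inP; exists q.
Qed.

Lemma below_neq0 X s v t :
  v \in alive X s -> s <= t -> below (alive X) s v t != set0.
Proof.
move=> vX; move/subnKC <-; elim: (t - s) => [|d /set0Pn[q qY]].
  rewrite addn0; apply/set0Pn; exists v.
  by case: (s) => [|u] /=; rewrite ?eqxx set11.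
have [q' q'X qq'] := alive_succ (subsetP (below_sub _ vX) _ qY).
by rewrite addnS; apply/set0Pn; exists q'; apply: below_step qq' q'X.
Qed.

(** The exact length [d] of the path is kept so that it can be counted down along a run. *)
Fixpoint hits X d t v (P : pred Q) : Prop :=
  if d is d'.+1 then
    exists v', [/\ v' \in X t.+1, edge t v v' & hits X d' t.+1 v' P]
  else P v.

Lemma below_hits X s v t q (P : pred Q) :
  q \in below X s v t -> P q -> exists d, hits X d s v P.
Proof.
move=> qY Pq; have: hits X 0 t q P by [].
elim: t {Pq} q 0 qY => [|t IH] q d /=; case: eqP => [-> /set1P -> |_].
- by exists d.
- by rewrite inE.
- by exists d.
rewrite inE => /andP[qX /exists_inP[q' q'Y q'q]] hq.
by apply: (IH q' d.+1) => //; exists q.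
Qed.

Hypothesis k_gt0 : 0 < k.

(* Visit the targets cyclically, following a finite path to the next one. *)
Lemma visit_all_targets X (tgt : 'I_k -> pred Q) s v :
  v \in alive X s ->
  (forall t q i, q \in alive X t -> exists d, hits (alive X) d t q (tgt i)) ->
  exists2 rho, ipath X s rho & forall i u, exists2 t, u <= t & tgt i (rho t).
Proof.
move=> vX reach; pose tg c := tgt (Ordinal (ltn_pmod c k_gt0)).
(* A triple holds the current state, the number of targets met so far, whose residue modulo [k]
   names the current target, and the distance left to that target. *)
pose P t (x : Q * nat * nat) :=
  x.1.1 \in alive X t /\ hits (alive X) x.2 t x.1.1 (tg x.1.2).
pose R t (x y : Q * nat * nat) := edge t x.1.1 y.1.1 /\
  if x.2 is d.+1 then y.1.2 = x.1.2 /\ y.2 = d else y.1.2 = x.1.2.+1.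
have [d0 d0P] := reach s v (Ordinal (ltn_pmod 0 k_gt0)) vX.
have [||f [f0 fP fR]] := @dependent_choice_at _ P R s (v, 0, d0).
- by [].
- move=> t [[q c] [|d]] _ [] /= qX.
    move=> _; have [q' q'X qq'] := alive_succ qX.
    have [d dP] := reach t.+1 q' (Ordinal (ltn_pmod c.+1 k_gt0)) q'X.
    by exists (q', c.+1, d).
  by move=> [q' [q'X qq' hq']]; exists (q', c, d).
exists (fun t => (f t).1.1).
  move=> t st; split; last by have [] := fR t st.
  by apply: (subsetP (alive_sub X t)); have [] := fP t st.
have arrive d t : s <= t -> (f t).2 = d ->
    exists t', [/\ s <= t', (f t').1.2 = (f t).1.2 & (f t').2 = 0].
  elim: d t => [|d IH] t st ft; first by exists t.
  have [_] := fR t st; rewrite ft => -[ct dt].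
  by have [t' [st' ct' dt']] := IH t.+1 (leqW st) dt; exists t'; rewrite ct' ct.
have counter c : exists t, [/\ s <= t, (f t).1.2 = c & (f t).2 = 0].
  elim: c => [|c [t [st ct dt]]].
    by have := arrive _ s (leqnn s) erefl; rewrite f0.
  have [_] := fR t st; rewrite dt ct => ct1.
  by have := arrive _ t.+1 (leqW st) erefl; rewrite ct1.
have count_le t : s <= t -> (f t).1.2 <= t.
  move/subnKC <-; elim: (t - s) => [|d IH]; first by rewrite addn0 f0.
  have [_] := fR (s + d) (leq_addr _ _); rewrite addnS.
  by case: (f (s + d)).2 => [-> //|m [-> _]]; apply: leqW.
(* The counter value [u * k + i] has residue [i], and since the counter never exceeds the time it is
   reached at some time at least [u]. *)
move=> i u; have [t [st ct dt]] := counter (u * k + i).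
exists t.
  apply: leq_trans (count_le t st); rewrite ct.
  exact: leq_trans (leq_pmulr _ k_gt0) (leq_addr _ _).
have [_] := fP t st; rewrite dt ct /= /tg; congr tgt.
by apply: val_inj; rewrite /= modnMDl modn_small.
Qed.

Hypothesis b_covers : forall i E,
  ~~ (B i \subset E) -> exists2 l, b l \subset B i & ~~ (b l \subset E).

Definition rejecting X :=
  forall s rho, ipath X s rho -> ~ streett_condition G B rho.

Definition avoids X E := forall t q, q \in X t -> q \notin E /\ q \notin good E.

(* Otherwise some path would meet every B i outside E infinitely often, and
   the remaining pairs cannot reject it because their G i is avoided. *)
Lemma peel X E s0 v0 :
  avoids X E -> rejecting X -> v0 \in alive X s0 ->
  exists s v l, [/\ v \in alive X s, ~~ (b l \subset E)
    & forall t q, q \in below (alive X) s v t -> q \notin b l].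
Proof.
move=> XE rej v0X; apply: contrapT => nP.
pose tgt i := [pred q | (B i \subset E) || (q \in B i)].
have [|rho Xrho often] := visit_all_targets (tgt := tgt) v0X.
  move=> t q i qX; have [BE|BnE] := boolP (B i \subset E).
    by exists 0; rewrite /= BE.
  have [l bB bnE] := b_covers BnE.
  have [t' [q' [q'Y q'b]]] :
      exists t' q', q' \in below (alive X) t q t' /\ q' \in b l.
    apply: contrapT => nQ; apply: nP; exists t, q, l; split=> // t' q' q'Y.
    by apply/negP => q'b; apply: nQ; exists t', q'.
  by apply: below_hits q'Y _; rewrite /= (subsetP bB _ q'b) orbT.
apply: (rej _ _ Xrho) => i /Inf_meets GI; apply/Inf_meets => u.
have [BE|BnE] := boolP (B i \subset E); last first.
  by have [t ut] := often i u; rewrite /= (negPf BnE); exists t.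
have [t st tG] := GI s0; have [tX _] := Xrho t st.
have [_ /negP[]] := XE t _ tX.
by rewrite inE; apply/existsP; exists i; rewrite BE.
Qed.

(** The difference [#|L| - labels_in E] counts the labels still usable on a branch; it drops
    whenever a tree adds some [b l] not inside [E]. *)
Definition labels_in E := #|[set l | b l \subset E]|.

Record ranked F E X T (p : nat -> Q -> place) : Prop := Ranked {
  ranked_valid : forall t q, T <= t -> q \in X t -> valid F E (p t q) q;
  ranked_step : forall t q q', T <= t -> q \in X t -> q' \in X t.+1 ->
    edge t q q' -> step (p t q) (p t.+1 q');
  ranked_progress : forall s rho x, T <= s -> ipath X s rho -> gap x ->
    ~ (forall t, s <= t -> p t (rho t) = x) }.

Lemma ranked_later F E X T T' p :
  T <= T' -> ranked F E X T p -> ranked F E X T' p.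
Proof.
move=> TT' [v st pg]; split=> [t q T't|t q q' T't|s rho x T's].
- exact: v (leq_trans TT' T't).
- exact: st (leq_trans TT' T't).
- exact: pg (leq_trans TT' T's).
Qed.

Lemma ranked_empty E X T :
  (forall s rho, ~ ipath X s rho) -> ranked Empty E X T (fun _ _ => Here).
Proof. by move=> nX; split=> // s rho x _ /nX. Qed.

(** Vertices outside [A] go to the leftmost gap, where every edge may lead; [Y] is the part covered
    by the first tree. *)
Definition tree_place l E A Y (pc pr : nat -> Q -> place) t q : place :=
  if q \notin A t then Here else
  if q \notin Y t then Next (pr t q) else
  if q \in good (E :|: b l) then Stop else In (pc t q).

(** [A] and [Y] are left abstract for two uses: the alive vertices and those below a chosen vertex
    when peeling, and all reachable vertices in both roles for the top tree. *)
Lemma ranked_tree l Fc Fr E X A Y T pc pr :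
  (forall t, A t \subset X t) -> (forall t, Y t \subset A t) ->
  (forall t q q', q \in X t -> edge t q q' -> q' \in A t.+1 -> q \in A t) ->
  (forall t q q', q \in Y t -> edge t q q' -> q' \in A t.+1 -> q' \in Y t.+1) ->
  (forall t q, q \in Y t -> q \notin E :|: b l) ->
  (forall s rho, ipath X s rho -> rho s \in A s) ->
  ranked Fc (E :|: b l) (fun t => Y t :\: good (E :|: b l)) T pc ->
  ranked Fr E (fun t => A t :\: Y t) T pr ->
  ranked (Tree l Fc Fr) E X T (tree_place l E A Y pc pr).
Proof.
move=> AX YA Apred Ysucc YE Xalive [vc sc gc] [vr sr gr]; rewrite /tree_place.
split=> [t q Tt qX|t q q' Tt qX q'X qq'|s rho x Ts Xrho gx px].
- case: ifPn => // /negbNE qA; case: ifPn => [qY|/negbNE qY] /=.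
    by apply: vr; rewrite // inE qY.
  case: ifPn => qg /=; rewrite (YE t) //=.
  by apply: vc; rewrite // inE qg.
- have [q'A|q'A] /= := boolP (q' \in A t.+1); last by case: (X in step X).
  rewrite (Apred t q q' qX qq' q'A) /=.
  have [qY|qY] /= := boolP (q \in Y t).
    rewrite (Ysucc t q q' qY qq' q'A) /=.
    case: ifPn => qg; case: ifPn => q'g //=.
    by apply: sc; rewrite // inE ?qg ?q'g //; apply: Ysucc qq' q'A.
  have [q'Y|q'Y] /= := boolP (q' \in Y t.+1); first by case: ifP.
  by apply: sr; rewrite // inE ?qY ?q'Y //; apply: Apred qq' q'A.
have inA t : s <= t -> rho t \in A t.
  by move=> st; apply: Xalive; apply: ipath_suffix Xrho.
case: x gx px => [||x|x] //= gx px.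
- by have := px s (leqnn s); rewrite inA //=; do 2?case: ifP.
- have inY t : s <= t -> rho t \in Y t :\: good (E :|: b l) /\ pc t (rho t) = x.
    move=> st; have := px t st; rewrite in_setD inA //=.
    by case: (rho t \in Y t); case: (rho t \in good _) => // -[].
  apply: (gc s rho x) => // [t st|t st]; last by have [] := inY t st.
  by have [] := inY t st; have [] := Xrho t st.
- have notY t : s <= t -> rho t \in A t :\: Y t /\ pr t (rho t) = x.
    move=> st; have := px t st; rewrite in_setD inA //=.
    by case: (rho t \in Y t) => /= [|[->]] //; case: ifP.
  apply: (gr s rho x) => // [t st|t st]; last by have [] := notY t st.
  by have [] := notY t st; have [] := Xrho t st.
Qed.

Lemma forest_exists E X m :
  avoids X E -> rejecting X -> (exists T, forall t, T <= t -> #|X t| <= m) ->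
  exists F T p, ranked F E X T p /\
    forall t, T <= t -> nodes F <= #|X t| * (#|L| - labels_in E).
Proof.
have [d] := ubnP (#|L| - labels_in E).
elim: d E X m => // d IHd E X m dE; elim: m X => [|m IHm] X XE rej [T0 T0P];
  (have [[s0 [v0 v0X]]|noalive] := pselect (exists s0 v0, v0 \in alive X s0);
   last by exists Empty, 0, (fun _ _ => Here); split=> //; apply: ranked_empty
     => s rho Xrho; apply: noalive; exists s, (rho s); apply/aliveP; exists rho).
  (* For width zero, the path of an alive vertex would meet an empty layer. *)
  case/aliveP: v0X => rho /(_ (maxn s0 T0) (leq_maxl _ _))[rX _] _.
  have := T0P _ (leq_maxr s0 T0); rewrite leqn0 cards_eq0 => /eqP X0.
  by rewrite X0 inE in rX.
have [s [v [l [vX bnE Yb]]]] := peel XE rej v0X.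
pose Y := below (alive X) s v; pose E' := E :|: b l.
have YaX t : Y t \subset alive X t by apply: below_sub.
have YX t : Y t \subset X t := subset_trans (YaX t) (alive_sub X t).
have YE' t q : q \in Y t -> q \notin E'.
  move=> qY; have [qE _] := XE t q (subsetP (YX t) q qY).
  by rewrite inE negb_or qE (Yb t).
pose Xc t := Y t :\: good E'; pose Xr t := alive X t :\: Y t.
have XcX t : Xc t \subset X t := subset_trans (subsetDl _ _) (YX t).
have XrX t : Xr t \subset X t := subset_trans (subsetDl _ _) (alive_sub X t).
have EE' : labels_in E < labels_in E'.
  apply/proper_card/properP; split; last by exists l; rewrite inE ?subsetUr.
  by apply/subsetP => l'; rewrite !inE => lE; apply/subsetU; rewrite lE.
have E'L : labels_in E' <= #|L| by apply: max_card.
(* The outer hypothesis holds for every width, so the trivial width [#|Q|] will do. *)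
have [|||Fc [Tc [pc [rc nc]]]] :=
  IHd E' Xc #|Q| _ _ _ (ex_intro _ 0 (fun t _ => max_card _)).
- by rewrite -ltnS; apply: leq_trans dE; rewrite ltnS ltn_sub2l // (leq_trans EE').
- by move=> t q; rewrite inE => /andP[qg /YE'].
- by move=> t rho /(ipath_sub XcX)/rej.
have splitX t : s <= t -> 0 < #|Y t| /\ #|Y t| + #|Xr t| <= #|X t|.
  move=> st; split; first by rewrite card_gt0 below_neq0.
  apply: leq_trans (subset_leq_card (alive_sub X t)).
  by rewrite -(cardsID (Y t) (alive X t)) (setIidPr (YaX t)).
have [|||Fr [Tr [pr [rr nr]]]] := IHm Xr.
- by move=> t q /(subsetP (XrX t))/XE.
- by move=> t rho /(ipath_sub XrX)/rej.
- exists (maxn s T0) => t; rewrite geq_max => /andP[/splitX[Y0 YXr] /T0P].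
  move/(leq_trans YXr) => Ym; rewrite -ltnS; apply: leq_trans Ym.
  by rewrite -add1n leq_add2r.
pose T := maxn s (maxn Tc Tr).
exists (Tree l Fc Fr), T, (tree_place l E (alive X) Y pc pr); split.
  apply: ranked_tree => //.
  - exact: alive_sub.
  - exact: alive_pred.
  - by move=> t q q'; apply: below_step.
  - by move=> u rho Xrho; apply/aliveP; exists rho.
  - by apply: ranked_later rc; rewrite leq_max leq_maxl orbT.
  - by apply: ranked_later rr; rewrite !leq_max leqnn !orbT.
move=> t; rewrite !geq_max => /and3P[st /nc ncY /nr nrX].
have [Y0 YXr] := splitX t st.
apply: leq_trans (leq_mul YXr (leqnn _)); rewrite mulnDl /= -addSn leq_add //.
have ncY' : nodes Fc <= #|Y t| * (#|L| - labels_in E').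
  by apply: leq_trans ncY _; rewrite leq_mul // subset_leq_card // subsetDl.
(* The label used here frees one unit per vertex of [Y t]; as [Y t] is nonempty, this pays for the
   root. *)
have -> : #|L| - labels_in E = (#|L| - (labels_in E).+1).+1.
  by rewrite subnSK // (leq_trans EE').
by rewrite mulnS -add1n leq_add // (leq_trans ncY') // leq_mul // leq_sub2l.
Qed.

End StreettForest.

(** * The complement automaton and its soundness *)

Lemma eq_Inf_suffix (Q : finType) (rho rho' : nat -> Q) s :
  (forall t, s <= t -> rho t = rho' t) -> Inf rho = Inf rho'.
Proof.
move=> eq_rho; apply/setP => q; apply/InfP/InfP => H i;
  have [j] := H (maxn i s); rewrite geq_max => /andP[ij /eq_rho eqj] jq.
- by exists j; rewrite -?eqj.
- by exists j; rewrite ?eqj.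
Qed.

Section Complement.

Variables (Sigma : finType) (A : omega_automaton Sigma).
Variables (k : nat) (G B : 'I_k -> {set state A}).
Variables (L : finType) (b : L -> {set state A}) (l0 : L).

Let Q : finType := state A.
Let N := #|Q| * #|L|.

(** Total by default: a word that does not start with a code stands for the empty forest. *)
Definition decode (c : seq (option L)) : forest L :=
  if pselect (exists F, exists s, code F ++ s = c) is left H
  then sval (cid H) else Empty.

Lemma decodeK F s : decode (code F ++ s) = F.
Proof.
rewrite /decode; case: pselect => [H|[]]; last by exists F, s.
by case: (cid H) => F' /= [s' /code_prefix_inj].
Qed.

(** The components are a padded forest code, the index of a place for each state ([None] being
    allowed for unreachable ones), and the breakpoint set. *)
Definition complement_state : finType :=
  ((N.*2.+1).-tuple (option L) * {ffun Q -> option 'I_(3 * N).+1} * {set Q})%type.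

Implicit Types x y : complement_state.

Definition state_forest x : forest L := decode x.1.1.

Definition state_rank x q : option place :=
  omap (fun i : 'I_(3 * N).+1 => nth Here (places (state_forest x)) i) (x.1.2 q).

Definition is_gap (p : option place) : bool :=
  if p is Some p' then gap p' else false.

Definition well_ranked x : bool :=
  [forall q, if state_rank x q is Some p
             then valid G B b (state_forest x) set0 p q else true].

Definition rank_step (p p' : option place) : bool :=
  match p, p' with
  | Some p1, Some p2 => step p1 p2
  | Some _, None => false
  | None, _ => true
  end.

(* Breakpoint construction: [O] collects the states that have stayed in the
   same gap since [O] was last empty. *)
Definition next_obligations a (r r' : Q -> option place) (O : {set Q}) : {set Q} :=
  if O == set0 then [set q | is_gap (r' q)]
  else [set q' | [exists q in O, ((q, a, q') \in trans A) && (r' q' == r q)]].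

Definition complement_trans x a y : bool :=
  [&& x.1.1 == y.1.1, well_ranked y,
      [forall q, forall q', ((q, a, q') \in trans A) ==>
         rank_step (state_rank x q) (state_rank y q')]
    & y.2 == next_obligations a (state_rank x) (state_rank y) x.2].

Definition complement : omega_automaton Sigma :=
  @OmegaAutomaton Sigma complement_state
    [set x | [&& well_ranked x, x.2 == set0
               & [forall q in init A, state_rank x q]]]
    [set xay | complement_trans xay.1.1 xay.1.2 xay.2]
    (buchi_condition [set x : complement_state | x.2 == set0]).

Lemma card_complement :
  #|state complement| =
  #|L|.+1 ^ N.*2.+1 * (3 * N).+2 ^ #|Q| * 2 ^ #|Q|.
Proof.
have card_sets : #|{set Q}| = 2 ^ #|Q|.
  by rewrite -[LHS]cardsT -powersetT card_powerset cardsT.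
by rewrite !card_prod card_tuple card_ffun !card_option card_ord card_sets.
Qed.

Hypothesis acceptance_streett : acceptance A = streett_condition G B.

Lemma complement_sound w : language complement w -> ~ language A w.
Proof.
move=> [x [[x0 xtr] acc]] [rho [[rho0 rhotr] accA]].
move: x0; rewrite inE => /and3P[wf0 _ /forall_inP init0].
have {}xtr t : complement_trans (x t) (w t) (x t.+1) by have := xtr t; rewrite inE.
have wf t : well_ranked (x t) by case: t => [//|t]; have /and4P[] := xtr t.
have forest_const t : state_forest (x t) = state_forest (x 0).
  elim: t => // t <-; have /and4P[/eqP e _ _ _] := xtr t.
  by rewrite /state_forest e.
have rstep t q q' : (q, w t, q') \in trans A ->
    rank_step (state_rank (x t) q) (state_rank (x t.+1) q').
  by have /and4P[_ _ /forallP/(_ q)/forallP/(_ q')/implyP] := xtr t.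
have someR t : state_rank (x t) (rho t).
  elim: t => [|t IH]; first exact: init0.
  by have := rstep t _ _ (rhotr t); case: (state_rank (x t) _) IH;
    case: (state_rank (x t.+1) _).
pose p t := odflt Here (state_rank (x t) (rho t)).
have pE t : state_rank (x t) (rho t) = Some (p t).
  by rewrite /p; case: (state_rank _ _) (someR t).
have /Inf_meets {}acc :
    Inf x :&: [set y : complement_state | y.2 == set0] != set0 by [].
have [||[s [y [gy py]]]|[E [rhoE often]]] :=
  @stable_or_good Q L k G B b (state_forest (x 0)) set0 rho p 0.
- move=> t _; have /forallP/(_ (rho t)) := wf t.
  by rewrite pE forest_const.
- by move=> t _; have := rstep t _ _ (rhotr t); rewrite !pE.
- have [t st] := acc s; rewrite inE => /eqP Ot.
  (* Once the rank of [rho] is a constant gap, the first breakpoint after that puts [rho] into the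
     obligations, which it never leaves, so they are never empty again. *)
  suff stuck d : rho (t + d).+1 \in (x (t + d).+1).2.
    have [t' tt'] := acc t.+1; rewrite inE => /eqP Ot'.
    have := stuck (t' - t.+1); rewrite -addSn subnKC // Ot'.
    by rewrite inE.
  have next u : (x u.+1).2 =
      next_obligations (w u) (state_rank (x u)) (state_rank (x u.+1)) (x u).2.
    by have /and4P[_ _ _ /eqP] := xtr u.
  elim: d => [|d IH].
    rewrite addn0 next /next_obligations Ot eqxx inE pE /=.
    by rewrite py // leqW.
  rewrite addnS next /next_obligations; case: ifPn => [/eqP O0|_].
    by rewrite O0 inE in IH.
  rewrite inE; apply/exists_inP; exists (rho (t + d).+1) => //.
  have st' : s <= (t + d).+1 by rewrite leqW // (leq_trans st) ?leq_addr.
  by rewrite rhotr !pE !py ?eqxx // leqW.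
- by rewrite acceptance_streett in accA; apply: (good_often_not_streett rhoE often).
Qed.

Hypothesis k_gt0 : 0 < k.
Hypothesis states_gt0 : 0 < #|Q|.
Hypothesis b_covers : forall i (E : {set Q}),
  ~~ (B i \subset E) -> exists2 l, b l \subset B i & ~~ (b l \subset E).
Hypothesis b_l0 : b l0 = set0.

(** * Completeness: an accepting run on each rejected word *)

Section Complete.

Variable w : nat -> Sigma.
Hypothesis w_notin : ~ language A w.

Let edge t q q' := (q, w t, q') \in trans A.

Fixpoint reachable t : {set Q} :=
  if t is u.+1 then [set q' | [exists q in reachable u, edge u q q']] else init A.

Lemma reachable_succ t q q' :
  q \in reachable t -> edge t q q' -> q' \in reachable t.+1.
Proof. by move=> qV qq'; rewrite inE; apply/exists_inP; exists q. Qed.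

Lemma reachable_prefix t q : q \in reachable t -> exists r : nat -> Q,
  [/\ r 0 \in init A, r t = q & forall i, i < t -> edge i (r i) (r i.+1)].
Proof.
elim: t q => [|t IH] q; first by exists (fun _ => q).
rewrite inE => /exists_inP[q' /IH[r [r0 rt redge]] q'q].
exists (fun i => if i <= t then r i else q); split=> //; first by rewrite ltnn.
move=> i; rewrite ltnS; case: ltngtP => // [it|->] _; first exact: redge.
by rewrite rt.
Qed.

(** A path in the reachable DAG extends backwards to a run, and the Streett condition depends only
    on the tail. *)
Lemma reachable_rejecting : rejecting G B edge reachable.
Proof.
move=> s rho Vrho streett; apply: w_notin.
have [/reachable_prefix[r [r0 rs redge]] _] := Vrho s (leqnn s).
pose rho' t := if t < s then r t else rho t.
have eq_rho t : s <= t -> rho' t = rho t by rewrite /rho' ltnNge => ->.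
have eq_r t : t <= s -> rho' t = r t by rewrite /rho'; case: ltngtP => // ->.
exists rho'; split; first split.
- by rewrite eq_r.
- move=> t; case: (leqP s t) => [st|ts].
    by rewrite !eq_rho ?leqW //; have [] := Vrho t st.
  by rewrite !eq_r // ?(ltnW ts) //; apply: redge.
- by rewrite acceptance_streett /streett_condition /= (eq_Inf_suffix eq_rho).
Qed.

Lemma complement_ranking : exists F (p : nat -> Q -> place),
  ranked G B b edge F set0 reachable 0 p /\ nodes F <= N.
Proof.
pose E0 : {set Q} := set0 :|: b l0; have E00 : E0 = set0 by rewrite /E0 b_l0 setU0.
pose X0 t := reachable t :\: good G B E0.
have [|||F0 [T [p0 [r0 n0]]]] :=
  @forest_exists Q L k G B b edge k_gt0 b_covers E0 X0 #|Q|.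
- by move=> t q; rewrite in_setD => /andP[qg _]; split; rewrite // E00 inE.
- move=> s rho Xrho; apply: reachable_rejecting (ipath_sub _ Xrho) => t.
  exact: subsetDl.
- by exists 0 => t _; apply: max_card.
pose F := Tree l0 F0 Empty.
pose p1 := tree_place G B b l0 set0 reachable reachable p0 (fun _ _ => Here).
have r1 : ranked G B b edge F set0 reachable T p1.
  apply: ranked_tree => //.
  - by move=> t q _; rewrite b_l0 setU0 inE.
  - by move=> s rho /(_ s (leqnn s))[].
  - by apply: ranked_empty => s rho /(_ s (leqnn s))[]; rewrite setDv inE.
exists F, (fun t q => if t < T then last_gap F else p1 t q); split; last first.
  (* The label [l0] already counts as used, which saves [#|Q|] nodes and so leaves room for the
     extra root. *)
  have lab : 0 < labels_in b E0.
    by apply/card_gt0P; exists l0; rewrite inE b_l0 sub0set.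
  have L0 : 0 < #|L| by apply/card_gt0P; exists l0.
  rewrite /= addn0; apply: (@leq_trans (#|Q| * (#|L| - 1)).+1).
    rewrite ltnS; apply: leq_trans (n0 T (leqnn T)) _.
    by rewrite leq_mul ?max_card ?leq_sub2l.
  by rewrite /N -{2}(subnK L0) mulnDr muln1 addnC -add1n leq_add2r.
case: r1 => v st pg; split=> [t q _ qV|t q q' _ qV q'V qq'|s rho x _ Vrho gx px].
- by case: ltnP => tT; [apply: valid_last_gap | apply: v].
- case: (ltnP t.+1 T) => t1T.
    by rewrite (ltnW t1T); apply: step_last_gap (valid_last_gap G B b F set0 q).
  case: ltnP => tT; last exact: st.
  exact: step_last_gap (v _ _ t1T q'V).
- apply: (pg (maxn s T) rho x) => //; first exact: leq_maxr.
    by apply: ipath_suffix Vrho; apply: leq_maxl.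
  move=> t; rewrite geq_max => /andP[/px + Tt].
  by rewrite ltnNge Tt.
Qed.

Lemma complement_complete : language complement w.
Proof.
have [F [p [[vF sF pF] nF]]] := complement_ranking.
have size_pad : size (code F ++ nseq (N.*2 - (nodes F).*2) None) == N.*2.+1.
  by rewrite size_cat size_code size_nseq addSn subnKC // leq_double.
pose c := Tuple size_pad.
pose f t := [ffun q : Q => if q \in reachable t
  then Some (inord (index (p t q) (places F)) : 'I_(3 * N).+1) else None].
pose r t q := if q \in reachable t then Some (p t q) else None.
pose O := fix O t := if t is u.+1
  then next_obligations (w u) (r u) (r u.+1) (O u) else set0.
pose x t : complement_state := (c, f t, O t).
have forestE t : state_forest (x t) = F by apply: decodeK.
have rankE t : state_rank (x t) = r t.
  apply/funext => q; rewrite /state_rank forestE ffunE /r; case: ifP => //= qV.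
  have pF' : p t q \in places F by apply: valid_places (vF t q _ qV).
  rewrite inordK ?nth_index // ltnS -ltnS.
  apply: leq_trans (_ : size (places F) <= _); first by rewrite index_mem.
  by rewrite size_places ltnS leq_mul.
have wf t : well_ranked (x t).
  apply/forallP => q; rewrite rankE /r; case: ifP => // qV.
  by rewrite forestE; apply: vF.
exists x; split; first split.
- rewrite inE wf eqxx /=; apply/forall_inP => q qI.
  by rewrite rankE /r /= qI.
- move=> t; rewrite inE /complement_trans /= eqxx wf !rankE eqxx andbT /=.
  apply/forallP => q; apply/forallP => q'; apply/implyP => qq'.
  rewrite /r; case: ifP => // qV; have q'V := reachable_succ qV qq'.
  by rewrite q'V; apply: sF.
(* If the obligations were nonempty from time [i] on, König's lemma would yield a path staying
   forever in one gap, against the progress of the ranking. *)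
apply/Inf_meets => i; apply: contrapT => nO.
have O_neq0 t : i <= t -> O t != set0.
  by move=> it; apply/negP => /eqP Ot; apply: nO; exists t; rewrite // inE /= Ot.
have O_gap t q : q \in O t -> is_gap (r t q).
  elim: t q => [|t IH] q; first by rewrite inE.
  rewrite /= /next_obligations; case: ifP => _; first by rewrite inE.
  by rewrite inE => /exists_inP[q' /IH gq' /andP[_ /eqP ->]].
pose stay t q q' := edge t q q' /\ r t.+1 q' = r t q.
have [|rho rhoi rhoR] := @koenig Q stay O i O_neq0.
  move=> t q' it; rewrite /= /next_obligations (negPf (O_neq0 t it)) inE.
  by case/exists_inP=> q qO /andP[qq' /eqP rq]; exists q.
have r_const t : i <= t -> r t (rho t) = r i (rho i).
  move/subnKC <-; elim: (t - i) => [|d IH]; first by rewrite addn0.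
  by rewrite addnS -IH; have [] := rhoR (i + d) (leq_addr _ _).
have := O_gap _ _ rhoi; case ri : (r i (rho i)) => [y|] //= gy.
have inV t : i <= t -> rho t \in reachable t /\ p t (rho t) = y.
  by move=> it; have := r_const t it; rewrite ri /r; case: ifP => // _ [].
apply: (pF i rho y) => // t it; last by have [] := inV t it.
by split; [have [] := inV t it | have [] := rhoR t it].
Qed.

End Complete.

Lemma complement_correct w : language complement w <-> ~ language A w.
Proof. by split; [apply: complement_sound | apply: complement_complete]. Qed.

End Complement.

(** * Explicit state bounds for the two labellings *)

Definition state_bound n m :=
  m.+1 ^ (n * m).*2.+1 * (3 * (n * m)).+2 ^ n * 2 ^ n.

Lemma complementation_bound_labels n k m :
  0 < n -> 0 < k ->
  (forall (Q : finType) (B : 'I_k -> {set Q}), #|Q| = n ->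
     exists (L : finType) (b : L -> {set Q}) (l0 : L),
       [/\ #|L| = m, b l0 = set0 & forall i (E : {set Q}), ~~ (B i \subset E) ->
         exists2 l, b l \subset B i & ~~ (b l \subset E)]) ->
  complementation_bound n k (state_bound n m).
Proof.
move=> n_gt0 k_gt0 labels Sigma A [G [B accA]] cardA.
have [L [b [l0 [cardL b_l0 b_covers]]]] := labels _ B cardA.
exists (complement G B b); split.
- by eexists.
- by rewrite card_complement cardA cardL.
- apply/funext => w; apply/propext.
  by apply: (complement_correct accA k_gt0 _ b_covers b_l0); rewrite cardA.
Qed.

Lemma complementation_bound_pairs n k :
  0 < n -> 0 < k -> complementation_bound n k (state_bound n k.+1).
Proof.
move=> n_gt0 k_gt0; apply: complementation_bound_labels => // Q B _.
exists (option 'I_k), (oapp B set0), None; split=> //.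
  by rewrite card_option card_ord.
by move=> i E BnE; exists (Some i).
Qed.

Lemma complementation_bound_states n k :
  0 < n -> 0 < k -> complementation_bound n k (state_bound n n.+1).
Proof.
move=> n_gt0 k_gt0; apply: complementation_bound_labels => // Q B cardQ.
exists (option Q), (oapp set1 set0), None; split=> //.
  by rewrite card_option cardQ.
move=> i E /subsetPn[q qB qE]; by exists (Some q); rewrite /= sub1set.
Qed.

(** An automaton without initial states accepts nothing, so an automaton for its complement has a
    run and hence a state. *)
Lemma complementation_bound_gt0 n k N :
  0 < n -> complementation_bound n k N -> 0 < N.
Proof.
move=> n_gt0 bnd.
pose G : 'I_k -> {set 'I_n} := fun _ => set0.
pose A := @OmegaAutomaton unit 'I_n set0 set0 (streett_condition G G).
have [||C [_ CN langC]] := bnd unit A; first by exists G, G.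
  by rewrite card_ord.
apply: leq_trans CN; have [rho [[rho0 _] _]] : language C (fun=> tt).
  by rewrite langC => -[rho [[]]]; rewrite inE.
by apply/card_gt0P; exists (rho 0).
Qed.

Lemma smallest_exists (P : nat -> Prop) N : P N -> exists M, is_smallest P M.
Proof.
move=> PN; have ex : exists M, `[< P M >] by exists N; apply/asboolP.
exists (ex_minn ex); case: ex_minnP => M /asboolP PM min; split=> // M' PM'.
by apply: min; apply/asboolP.
Qed.

Lemma state_bound_le n k : 1 < n -> 0 < k ->
  state_bound n k.+1 <= (n ^ n * k ^ (n * k)) ^ 15.
Proof.
move=> n_gt1 k_gt0; have n_gt0 := ltnW n_gt1.
have pow2 : 2 ^ n <= n ^ n by rewrite leq_exp2r.
have powp : (3 * (n * k.+1)).+2 ^ n <= n ^ (4 * n) * k ^ (n * k).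
  apply: (@leq_trans ((n ^ 4 * k) ^ n)).
    rewrite leq_exp2r // !expnS expn0 muln1.
    apply: (@leq_trans (2 * (2 * (2 * (n * k))))); first by nia.
    by rewrite -!mulnA !leq_mul.
  by rewrite expnMn expnM leq_mul // leq_pexp2l // leq_pmulr.
(* The exponent is at most [5 * (n * k)]. For [k] at least 2 the base is at most [k ^ 2]; for
   [k = 1] it is 3, at most [n ^ 2]. *)
have powc : k.+2 ^ (n * k.+1).*2.+1 <= n ^ (10 * n) * k ^ (10 * (n * k)).
  apply: (@leq_trans (k.+2 ^ (5 * (n * k)))).
    by rewrite leq_pexp2l //; nia.
  case: (ltngtP k 1) => [|k1|->]; first by rewrite ltnNge k_gt0.
    apply: (@leq_trans (k ^ (10 * (n * k)))); last first.
      by rewrite leq_pmull // expn_gt0 n_gt0.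
    rewrite (_ : 10 * (n * k) = 2 * (5 * (n * k))); last lia.
    rewrite [leqRHS]expnM leq_exp2r ?muln_gt0 ?n_gt0 //.
    by rewrite expnS expn1; nia.
  rewrite exp1n !muln1 (_ : 10 * n = 2 * (5 * n)); last lia.
  rewrite [leqRHS]expnM leq_exp2r ?muln_gt0 ?n_gt0 //.
  by rewrite expnS expn1; nia.
apply: leq_trans (leq_mul (leq_mul powc powp) pow2) _.
(* The constant 15 is the sum 10 + 4 + 1 of the exponents of [n ^ n]. *)
have -> : n ^ (10 * n) * k ^ (10 * (n * k)) * (n ^ (4 * n) * k ^ (n * k)) * n ^ n
        = n ^ (15 * n) * k ^ (11 * (n * k)).
  rewrite mulnACA -mulnA [_ * n ^ n]mulnC mulnA -!expnD.
  by congr (_ ^ _ * _ ^ _); lia.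
rewrite expnMn -!expnM ![_ * 15]mulnC leq_mul // leq_pexp2l //.
by rewrite leq_mul.
Qed.

Lemma state_bound_diag_le n : 1 < n ->
  state_bound n n.+1 <= (n ^ (n * n)) ^ 30.
Proof.
move=> n_gt1; have n_gt0 := ltnW n_gt1.
apply: leq_trans (state_bound_le n_gt1 n_gt0) _.
rewrite (expnM _ 2 15) leq_exp2r // -expnM muln2 -addnn expnD.
rewrite leq_mul // leq_pexp2l //.
by rewrite leq_pmull.
Qed.

(* Passage to logarithms and asymptotics *)
From mathcomp Require Import all_order all_algebra.
From mathcomp Require Import all_classical all_reals all_analysis.

Import Order.TTheory GRing.Theory Num.Theory.
Import numFieldNormedType.Exports.
Local Open Scope classical_set_scope.
Local Open Scope ring_scope.

Lemma ln_nat_ge0 (R : realType) n : 0 <= ln (n%:R : R).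
Proof.
case: n => [|n]; first by rewrite ln0.
by apply: ln_ge0; rewrite ler1n.
Qed.

Lemma ln_natX (R : realType) n d :
  (0 < n)%N -> ln ((n ^ d)%:R : R) = d%:R * ln n%:R.
Proof. by move=> n_gt0; rewrite natrX lnXn ?ltr0n // mulr_natl. Qed.

(** The exponent is [lg (f n)], and a [d]-th power only multiplies the logarithm by the constant
    [d]. *)
Lemma exp2_bigO_le (R : realType) (f e : nat -> nat) (g : nat -> R) d :
  (0 < d)%N -> (forall n, (0 < n)%N -> (0 < f n)%N) ->
  (forall n, (1 < n)%N -> (f n <= e n ^ d)%N) ->
  (forall n, (1 < n)%N -> lg (e n)%:R = g n) ->
  exp2_bigO f g.
Proof.
move=> d_gt0 f_gt0 f_le lg_e.
have ln2_gt0 : 0 < ln (2 : R) by rewrite ln_gt0 // ltr1n.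
exists (fun n => lg (f n)%:R); split; last first.
  move=> n n_gt0; rewrite /powR pnatr_eq0 /= /lg divfK ?gt_eqF //.
  by rewrite lnK // posrE ltr0n f_gt0.
apply/eqO_exP; exists d%:R; first by rewrite ltr0n.
exists 2%N => // n /= n_gt1.
have f0 := f_gt0 n (ltnW n_gt1).
have e0 : (0 < e n)%N.
  by have := leq_trans f0 (f_le n n_gt1); rewrite expn_gt0 (gtn_eqF d_gt0) orbF.
have lg_ge0 m : 0 <= lg (m%:R : R) by rewrite divr_ge0 ?ln_nat_ge0 ?ltW.
rewrite -lg_e // !ger0_norm // /lg mulrA ler_pM2r ?invr_gt0 //.
by rewrite -ln_natX // ler_ln ?posrE ?ltr0n ?expn_gt0 ?e0 // ler_nat f_le.
Qed.

Theorem mainTheorem1 (R : realType) :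
  exists U : nat -> nat -> nat,
    (forall n k : nat, (0 < n)%N -> (0 < k)%N ->
       is_smallest (complementation_bound n k) (U n k)) /\
    (forall k : nat -> nat, (forall n : nat, (0 < n)%N -> (0 < k n)%N) ->
       ((fun n : nat => (k n)%:R : R) =O_\oo (fun n : nat => n%:R : R) ->
        exp2_bigO (fun n : nat => U n (k n))
          (fun n : nat => n%:R * lg (n%:R : R)
                          + n%:R * (k n)%:R * lg ((k n)%:R : R))) /\
       ((fun n : nat => n%:R : R) =o_\oo (fun n : nat => (k n)%:R : R) ->
        exp2_bigO (fun n : nat => U n (k n))
          (fun n : nat => n%:R ^+ 2 * lg (n%:R : R)))).
Proof.
have smallest (nk : nat * nat) : exists M, (0 < nk.1)%N -> (0 < nk.2)%N ->
    is_smallest (complementation_bound nk.1 nk.2) M.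
  have [/andP[n0 k0]|/nandP nk0] := boolP ((0 < nk.1) && (0 < nk.2))%N.
    have [M MP] := smallest_exists (complementation_bound_pairs n0 k0).
    by exists M.
  by exists 0%N => n0 k0; case: nk0; rewrite ?n0 ?k0.
have [U UP] := choice smallest.
exists (fun n k => U (n, k)); split=> [n k|k k_gt0]; first exact: (UP (n, k)).
have U_gt0 n : (0 < n)%N -> (0 < U (n, k n))%N.
  move=> n0; have [bnd _] := UP (n, k n) n0 (k_gt0 n n0).
  exact: complementation_bound_gt0 bnd.
have U_le n N : (0 < n)%N -> complementation_bound n (k n) N -> (U (n, k n) <= N)%N.
  by move=> n0; have [_] := UP (n, k n) n0 (k_gt0 n n0); apply.
split=> _.
(* The comparison function is chosen so that its [lg] is exactly the required sum. *)
- apply: (@exp2_bigO_le _ _ (fun n => n ^ n * k n ^ (n * k n))%N _ 15) => // n n_gt1.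
    have n0 := ltnW n_gt1; have k0 := k_gt0 n n0.
    exact: leq_trans (U_le _ _ n0 (complementation_bound_pairs n0 k0))
      (state_bound_le n_gt1 k0).
  have n0 := ltnW n_gt1; have k0 := k_gt0 n n0.
  rewrite /lg natrM lnM ?posrE ?ltr0n ?expn_gt0 ?n0 ?k0 // !ln_natX //.
  by rewrite natrM mulrDl !mulrA.
- apply: (@exp2_bigO_le _ _ (fun n => n ^ (n * n))%N _ 30) => // n n_gt1.
    have n0 := ltnW n_gt1; have k0 := k_gt0 n n0.
    exact: leq_trans (U_le _ _ n0 (complementation_bound_states n0 k0))
      (state_bound_diag_le n_gt1).
  by rewrite /lg ln_natX ?(ltnW n_gt1) // natrM expr2 !mulrA.
Qed.
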